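(* Let $d\ge 1$ be a constant. Given a set of $n$ trajectories in $\mathbb{R}^d$, each with vertices at times $t_0,\dots,t_\tau$, and $\varepsilon>0$, a central trajectory has worst-case complexity $O(\tau n^{5/2})$.
   Context: Setting: $\mathcal{X}$ is a set of $n$ entities, each moving in $\mathbb{R}^d$ along a piecewise-linear trajectory $\sigma:[t_0,t_\tau]\to\mathbb{R}^d$ with vertices at the common times $t_0<\dots<t_\tau$; trajectories are in general position (no three trajectories pass through the same point at the same time, and no two pairs of entities are at distance exactly $\varepsilon$ at the same time). Two entities $\sigma,\psi$ are $\varepsilon$-connected at time $t$ if there is a sequence $\sigma=\sigma_0,\dots,\sigma_k=\psi$ with $\|\sigma_j(t)\sigma_{j+1}(t)\|\le\varepsilon$ for all $j$ (Euclidean distance). A trajectoid is a function $\mathcal{T}:[t_0,t_\tau]\to\mathcal{X}$ such that whenever $\mathcal{T}$ is discontinuous at time $t$, switching from $\sigma$ to $\psi$, then $\sigma,\psi$ are $\varepsilon$-connected at time $t$. $D(\sigma,t)=\max_{\psi\in\mathcal{X}}\|\sigma(t)\psi(t)\|$. A central trajectory is a trajectoid minimizing $\int_{t_0}^{t_\tau}D(\mathcal{T}(t),t)\,dt$. The complexity of a trajectoid is the number of pieces of the curve $t\mapsto\mathcal{T}(t)(t)$, i.e. the number of maximal time intervals on which $\mathcal{T}$ is a single entity and that entity moves linearly. *)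

(* Defs.v *)
From Stdlib Require Import Reals Lra List.
Open Scope R_scope.

(* Points of R^d are functions nat -> R; only coordinates j < d matter. *)
Fixpoint sqdist (d : nat) (x y : nat -> R) : R :=
  match d with
  | O => 0
  | S d' => sqdist d' x y + (x d' - y d') ^ 2
  end.

Definition dist (d : nat) (x y : nat -> R) : R := sqrt (sqdist d x y).

(* A family of n trajectories: entity i (i < n) is at position sig i t. *)
Definition traj := nat -> R -> (nat -> R).

Definition increasing_times (tau : nat) (tm : nat -> R) : Prop :=
  forall k, (k < tau)%nat -> tm k < tm (S k).

Definition piecewise_linear (d n tau : nat) (tm : nat -> R) (sig : traj) : Prop :=
  forall i k, (i < n)%nat -> (k < tau)%nat ->
  forall s, tm k <= s <= tm (S k) ->
  forall j, (j < d)%nat ->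
    sig i s j = sig i (tm k) j
      + (s - tm k) / (tm (S k) - tm k) * (sig i (tm (S k)) j - sig i (tm k) j).

Definition same_point (d : nat) (x y : nat -> R) : Prop :=
  forall j, (j < d)%nat -> x j = y j.

Definition general_position (d n tau : nat) (tm : nat -> R) (sig : traj) (eps : R) : Prop :=
  (forall s, tm 0%nat <= s <= tm tau ->
   forall i j k, (i < n)%nat -> (j < n)%nat -> (k < n)%nat ->
     i <> j -> j <> k -> i <> k ->
     ~ (same_point d (sig i s) (sig j s) /\ same_point d (sig j s) (sig k s)))
  /\
  (forall s, tm 0%nat <= s <= tm tau ->
   forall i j k l, (i < n)%nat -> (j < n)%nat -> (k < n)%nat -> (l < n)%nat ->
     i <> j -> k <> l -> ~ ((i = k /\ j = l) \/ (i = l /\ j = k)) ->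
     ~ (dist d (sig i s) (sig j s) = eps /\ dist d (sig k s) (sig l s) = eps)).

Inductive eps_connected (d n : nat) (sig : traj) (eps s : R) : nat -> nat -> Prop :=
  | ec_refl : forall i, (i < n)%nat -> eps_connected d n sig eps s i i
  | ec_step : forall i j k, (i < n)%nat -> (j < n)%nat ->
      dist d (sig i s) (sig j s) <= eps ->
      eps_connected d n sig eps s j k ->
      eps_connected d n sig eps s i k.

(* A trajectoid: a map from times to entities; near every time s, the only
   entities used are eps-connected (at time s) to the one used at s.
   (This is the condition "whenever T is discontinuous at s, switching from
   sigma to psi, sigma and psi are eps-connected at s".) *)
Definition trajectoid (d n tau : nat) (tm : nat -> R) (sig : traj) (eps : R)
  (T : R -> nat) : Prop :=
  (forall s, tm 0%nat <= s <= tm tau -> (T s < n)%nat) /\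
  (forall s, tm 0%nat <= s <= tm tau ->
   exists delta, delta > 0 /\
     forall u, tm 0%nat <= u <= tm tau -> Rabs (u - s) < delta ->
       eps_connected d n sig eps s (T s) (T u)).

Definition Dmax (d n : nat) (sig : traj) (i : nat) (s : R) : R :=
  fold_right (fun j acc => Rmax (dist d (sig i s) (sig j s)) acc) 0 (seq 0 n).

Definition cost (d n : nat) (sig : traj) (T : R -> nat) : R -> R :=
  fun s => Dmax d n sig (T s) s.

Definition central_trajectory (d n tau : nat) (tm : nat -> R) (sig : traj) (eps : R)
  (T : R -> nat) : Prop :=
  trajectoid d n tau tm sig eps T /\
  exists pr : Riemann_integrable (cost d n sig T) (tm 0%nat) (tm tau),
    forall T', trajectoid d n tau tm sig eps T' ->
    forall pr' : Riemann_integrable (cost d n sig T') (tm 0%nat) (tm tau),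
      RiemannInt pr <= RiemannInt pr'.

Definition complexity_le (d tau : nat) (tm : nat -> R) (sig : traj)
  (T : R -> nat) (k : nat) : Prop :=
  exists b : nat -> R,
    b 0%nat = tm 0%nat /\ b k = tm tau /\
    (forall i, (i < k)%nat -> b i < b (S i)) /\
    (forall i, (i < k)%nat ->
      exists e (p q : nat -> R),
        forall s, b i < s < b (S i) ->
          T s = e /\ forall j, (j < d)%nat -> sig e s j = p j + s * q j).

(* Main.v *)
From Stdlib Require Import Reals Lra Lia List Psatz Classical Wf_nat IndefiniteDescription.
From Coquelicot Require Import Coquelicot.
Require Import Defs.
Open Scope R_scope.

(** On a time edge all squared distances are quadratic in time.  Cut time into
    O(tau n^2) elementary intervals on which the relation "at distance at most
    eps" is constant and every D(sigma, .)^2 is one quadratic.  A trajectoid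
    stays in one eps-component on each of them, and inside a component it may
    switch freely, so a central trajectory follows the lower envelope of the
    functions D over the components visited by a best one among finitely many
    paths of components.

    On the j-th interval let S_j be an irreducible set of entities realising the
    envelope.  The envelope has O(|S_j|) pieces, and any two members of S_j swap
    their order inside the interval.  A fixed pair swaps O(tau n) times
    altogether, because D(sigma, .)^2 has O(n) quadratic pieces per edge; hence
    the sum of |S_j|(|S_j| - 1) is O(tau n^3), and by AM-GM the sum of the |S_j|
    over O(tau n^2) intervals is O(tau n^(5/2)). *)

(** * Partitions of an interval into boundedly many pieces *)

(** The number is only an upper bound: [parts_nil] accepts any [k], so leftover budget is harmless
    and bounds can be added freely. *)
Inductive parts (P : R -> R -> Prop) : nat -> R -> R -> Prop :=
  | parts_nil : forall k a, parts P k a a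
  | parts_cons : forall k a b c, a < b -> P a b -> parts P k b c ->
      parts P (S k) a c.

Definition hereditary (P : R -> R -> Prop) : Prop :=
  forall a b a' b', a <= a' -> a' < b' -> b' <= b -> P a b -> P a' b'.

Lemma parts_le P k a b : parts P k a b -> a <= b.
Proof. induction 1; lra. Qed.

Lemma parts_weaken P k l a b : (k <= l)%nat -> parts P k a b -> parts P l a b.
Proof.
  intros Hkl H; revert l Hkl; induction H; intros l Hkl.
  - constructor.
  - destruct l; [lia|]; econstructor; eauto; apply IHparts; lia.
Qed.

Lemma parts_one (P : R -> R -> Prop) a b :
  a <= b -> (a < b -> P a b) -> parts P 1 a b.
Proof.
  intros [H| ->] HP; [|constructor].
  econstructor; [exact H|auto|constructor].
Qed.

Lemma parts_mono (P Q : R -> R -> Prop) k a b :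
  (forall u v, a <= u -> u < v -> v <= b -> P u v -> Q u v) ->
  parts P k a b -> parts Q k a b.
Proof.
  intros HPQ H; revert HPQ; induction H; intros HPQ; [constructor|].
  pose proof (parts_le _ _ _ _ H1).
  econstructor; [exact H|apply HPQ; auto; lra|].
  apply IHparts; intros; apply HPQ; auto; lra.
Qed.

Lemma parts_app P k l a b c :
  parts P k a b -> parts P l b c -> parts P (k + l) a c.
Proof.
  induction 1; intros; simpl.
  - eapply parts_weaken; [|eassumption]; lia.
  - econstructor; eauto.
Qed.

Fixpoint nsum (f : nat -> nat) (m : nat) : nat :=
  match m with O => O | S m' => (nsum f m' + f m')%nat end.

Lemma parts_concat P (f : nat -> nat) (p : nat -> R) m :
  (forall j, (j < m)%nat -> parts P (f j) (p j) (p (S j))) ->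
  parts P (nsum f m) (p 0%nat) (p m).
Proof.
  induction m; intros H; simpl; [constructor|].
  eapply parts_app; [apply IHm; intros; apply H; lia | apply H; lia].
Qed.

(** Sweep from the left and cut at the earlier of the two first breakpoints. Every cut finishes a
    piece of at least one partition, and heredity keeps the property on what remains of the other
    piece. *)
Lemma parts_merge P Q k l a b :
  hereditary P -> hereditary Q -> parts P k a b -> parts Q l a b ->
  parts (fun u v => P u v /\ Q u v) (k + l) a b.
Proof.
  intros hP hQ.
  remember (k + l)%nat as N eqn:HN; revert k l a HN.
  induction N as [N IH] using lt_wf_ind; intros k l a HN HPk HQl.
  inversion HPk as [|k1 ? m ? Ham Pam HPk1]; subst; [constructor|].
  inversion HQl as [|l1 ? m' ? Ham' Qam' HQl1]; subst.
  - pose proof (parts_le _ _ _ _ HPk1); lra.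
  - destruct (Rtotal_order m m') as [Hm|[Hm|Hm]].
    + simpl; apply parts_cons with m; auto.
      * split; auto; eapply hQ; [| | |exact Qam']; lra.
      * apply (IH (k1 + S l1)%nat) with k1 (S l1); auto; try lia.
        apply parts_cons with m'; auto.
        eapply hQ; [| | |exact Qam']; lra.
    + subst m'; simpl; apply parts_cons with m; auto.
      apply parts_weaken with (k1 + l1)%nat; [lia|].
      apply (IH (k1 + l1)%nat) with k1 l1; auto; lia.
    + simpl; apply parts_cons with m'; auto.
      * split; auto; eapply hP; [| | |exact Pam]; lra.
      * apply parts_weaken with (S k1 + l1)%nat; [lia|].
        apply (IH (S k1 + l1)%nat) with (S k1) l1; auto; try lia.
        apply parts_cons with m; auto.
        eapply hP; [| | |exact Pam]; lra.
Qed.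

Lemma hereditary_and P Q : hereditary P -> hereditary Q ->
  hereditary (fun u v => P u v /\ Q u v).
Proof. intros hP hQ a b a' b' H1 H2 H3 []; split; eauto. Qed.

Lemma hereditary_all (P : nat -> R -> R -> Prop) N :
  (forall i, hereditary (P i)) ->
  hereditary (fun u v => forall i, (i < N)%nat -> P i u v).
Proof. intros hP a b a' b' H1 H2 H3 H i Hi; eapply hP; eauto. Qed.

Lemma parts_all (G : R -> R -> Prop) (P : nat -> R -> R -> Prop) N m k a b :
  hereditary G -> (forall i, hereditary (P i)) ->
  parts G m a b -> (forall i, (i < N)%nat -> parts (P i) k a b) ->
  parts (fun u v => G u v /\ forall i, (i < N)%nat -> P i u v) (m + N * k) a b.
Proof.
  intros hG hP HG; induction N; intros H.
  - rewrite Nat.add_0_r; eapply parts_mono; [|exact HG].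
    intros; split; auto; intros; lia.
  - apply parts_weaken with ((m + N * k) + k)%nat; [lia|].
    eapply parts_mono; [|apply parts_merge; [| |apply IHN; auto|apply (H N); lia]].
    + intros u v _ _ _ [[HGuv Hall] HN]; split; auto; intros i Hi.
      destruct (Nat.eq_dec i N) as [->|]; auto; apply Hall; lia.
    + apply hereditary_and; auto; apply hereditary_all; auto.
    + auto.
Qed.

(** Passes from the inductive form to an explicit sequence of breakpoints, the form in which
    complexity is stated. *)
Lemma parts_sequence P k a b : parts P k a b ->
  exists (m : nat) (p : nat -> R), (m <= k)%nat /\ p 0%nat = a /\ p m = b /\
    forall j, (j < m)%nat -> p j < p (S j) /\ P (p j) (p (S j)).
Proof.
  induction 1 as [k a|k a b c Hab HP H IH].
  - exists 0%nat, (fun _ => a); repeat split; auto; try lia; intros; lia.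
  - destruct IH as (m & p & Hm & H0 & Hp & Hj).
    exists (S m), (fun j => match j with O => a | S j' => p j' end).
    repeat split; auto; try lia; destruct j; subst; auto; apply Hj; lia.
Qed.

Definition avoids (L : list R) (u v : R) : Prop :=
  forall r, In r L -> ~ (u < r < v).

Lemma hereditary_avoids L : hereditary (avoids L).
Proof. intros a b a' b' H1 H2 H3 H r Hr ?; apply (H r Hr); lra. Qed.

(** Each point contributes a partition into two pieces and merging adds the counts; the crude factor
    2 only affects the final constant. *)
Lemma parts_avoids (L : list R) a b : a <= b ->
  parts (avoids L) (2 * length L + 1) a b.
Proof.
  intros Hab; induction L as [|r L IH].
  - apply parts_one; auto; intros _ r [].
  - apply parts_weaken with (2 * length L + 1 + 2)%nat; [simpl; lia|].
    assert (Hr : parts (avoids (r :: nil)) 2 a b).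
    { destruct (Rlt_le_dec a r) as [Har|]; [destruct (Rlt_le_dec r b) as [Hrb|]|].
      - apply parts_cons with r; auto; [|apply parts_one; [lra|intros _]];
          intros x [<-|[]]; lra.
      - apply parts_weaken with 1%nat; [lia|]; apply parts_one; auto.
        intros _ x [<-|[]]; lra.
      - apply parts_weaken with 1%nat; [lia|]; apply parts_one; auto.
        intros _ x [<-|[]]; lra. }
    eapply parts_mono; [|apply parts_merge; [| |exact IH|exact Hr]];
      try apply hereditary_avoids.
    intros u v _ _ _ [H1 H2] x [<-|Hx]; [apply H2; left; auto|auto].
Qed.

(** * Lower envelopes of quadratics *)

Definition convex_set (U : R -> Prop) : Prop :=
  forall x y z, x <= y <= z -> U x -> U z -> U y.

Definition decided (U : R -> Prop) (u v : R) : Prop :=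
  (forall s, u < s < v -> U s) \/ (forall s, u < s < v -> ~ U s).

Lemma hereditary_decided U : hereditary (decided U).
Proof.
  intros a b a' b' H1 H2 H3 [H|H]; [left|right]; intros; apply H; lra.
Qed.

(** Within the open interval a convex set is an interval up to its end points, so cutting at its
    infimum and supremum decides membership; two cut points give 2 * 2 + 1 pieces. *)
Lemma parts_convex U a b : a <= b -> convex_set U -> parts (decided U) 5 a b.
Proof.
  intros Hab HU.
  destruct (classic (exists s, a < s < b /\ U s)) as [(s0 & Hs0 & HUs0)|HN].
  - destruct (completeness (fun x => a < x < b /\ U x)) as (M & HM1 & HM2).
    { exists b; intros x []; lra. }
    { exists s0; auto. }
    (* [completeness] yields suprema only; the infimum is [- m], with [m] the supremum of the
       reflected set. *)
    destruct (completeness (fun x => a < - x < b /\ U (- x))) as (m & Hm1 & Hm2).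
    { exists (- a); intros x []; lra. }
    { exists (- s0); rewrite Ropp_involutive; auto. }
    apply parts_mono with (avoids (- m :: M :: nil));
      [|apply (parts_avoids (- m :: M :: nil)); auto].
    intros u v Hu Huv Hv Hav.
    assert (Av1 := Hav (- m) (or_introl eq_refl)).
    assert (Av2 := Hav M (or_intror (or_introl eq_refl))).
    destruct (Rle_lt_dec M u) as [HMu|HMu]; [|destruct (Rle_lt_dec v (- m)) as [Hmv|Hmv]].
    + right; intros s Hs HUs.
      assert (s <= M) by (apply HM1; split; auto; lra); lra.
    + right; intros s Hs HUs.
      assert (- s <= m); [|lra].
      apply Hm1; rewrite Ropp_involutive; split; auto; lra.
    + left; intros s Hs.
      assert (Hx : exists x, s < x /\ U x).
      { apply NNPP; intros HC.
        assert (M <= s); [|lra].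
        apply HM2; intros x [_ HUx]; apply Rnot_lt_le; intros ?; apply HC; eauto. }
      assert (Hy : exists y, y < s /\ U y).
      { apply NNPP; intros HC.
        assert (m <= - s); [|lra].
        apply Hm2; intros x [_ HUx]; apply Rnot_lt_le; intros ?; apply HC.
        exists (- x); split; auto; lra. }
      destruct Hx as (x & ? & ?), Hy as (y & ? & ?).
      apply (HU y s x); auto; lra.
  - apply parts_weaken with 1%nat; [lia|]; apply parts_one; auto.
    intros _; right; intros s Hs HUs; apply HN; eauto.
Qed.

Definition quad (c : R * R * R) (s : R) : R :=
  let '(A, B, C) := c in A * s ^ 2 + B * s + C.

Definition lead (c : R * R * R) : R := fst (fst c).

Definition lowest {I : Type} (f : I -> R -> R) (l : list I) (u v : R) : Prop :=
  exists i, In i l /\ forall i' s, In i' l -> u < s < v -> f i s <= f i' s.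

Lemma hereditary_lowest {I} (f : I -> R -> R) l : hereditary (lowest f l).
Proof.
  intros a b a' b' H1 H2 H3 (i & Hi & H); exists i; split; auto.
  intros; apply H; auto; lra.
Qed.

Lemma exists_max {I} (f : I -> R) (l : list I) : l <> nil ->
  exists i, In i l /\ forall i', In i' l -> f i' <= f i.
Proof.
  induction l as [|x l IH]; [easy|intros _].
  destruct l as [|y l].
  - exists x; split; [left; auto|]; intros i' [<-|[]]; lra.
  - destruct IH as (i & Hi & Hmax); [easy|].
    destruct (Rle_lt_dec (f x) (f i)).
    + exists i; split; [right; auto|]; intros i' [<-|]; auto.
    + exists x; split; [left; auto|]; intros i' [<-|Hi']; [lra|].
      apply Hmax in Hi'; lra.
Qed.

(** The difference of the two quadratics has a nonnegative leading coefficient, so it is a convex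
    function and its strict sublevel set at 0 is an interval. *)
Lemma convex_below c c' : lead c' <= lead c ->
  convex_set (fun s => quad c s < quad c' s).
Proof.
  destruct c as [[A B] C], c' as [[A' B'] C']; unfold lead, quad; simpl.
  intros HA x y z [Hxy Hyz] Hx Hz.
  destruct Hyz as [Hyz| ->]; [|auto].
  assert (0 <= (A - A') * ((y - x) * (z - y))) by
    (apply Rmult_le_pos; [lra|apply Rmult_le_pos; lra]).
  set (g := fun s => (A - A') * s ^ 2 + (B - B') * s + (C - C')).
  (* Linear interpolation of [g] between [x] and [z], with its exact second-order error. *)
  assert (Hg : g y * (z - x) = g x * (z - y) + g z * (y - x)
    - (A - A') * ((y - x) * (z - y)) * (z - x)) by (unfold g; ring).
  assert (g x < 0) by (unfold g; lra).
  assert (g z < 0) by (unfold g; lra).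
  assert (g y < 0); [|unfold g in *; lra].
  clearbody g; apply Rnot_le_lt; intros Hy.
  assert (0 <= g y * (z - x)) by (apply Rmult_le_pos; lra).
  assert (0 <= (A - A') * ((y - x) * (z - y)) * (z - x)) by
    (apply Rmult_le_pos; lra).
  assert (g x * (z - y) < 0) by nra.
  assert (g z * (y - x) <= 0) by nra.
  lra.
Qed.

(* The quadratic with the largest leading coefficient lies below all the others
   on a convex set, so inserting it last costs a bounded number of pieces. *)
Lemma parts_lowest {I} (q : I -> R * R * R) (l : list I) a b : a <= b ->
  l <> nil -> parts (lowest (fun i => quad (q i)) l) (5 * length l) a b.
Proof.
  intros Hab; remember (length l) as N eqn:HN; revert l HN.
  induction N as [|N IH]; intros l HN Hl; [destruct l; easy|].
  destruct (exists_max (fun i => lead (q i)) l Hl) as (i & Hi & Hmax).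
  destruct (in_split _ _ Hi) as (l1 & l2 & ->).
  set (l' := l1 ++ l2).
  assert (Hin : forall x, In x (l1 ++ i :: l2) <-> x = i \/ In x l').
  { intros x; unfold l'; rewrite !in_app_iff; simpl; intuition. }
  assert (Hlen : N = length l').
  { unfold l'; rewrite length_app in *; simpl in HN; lia. }
  destruct (classic (l' = nil)) as [Hnil|Hcons].
  - apply parts_weaken with 1%nat; [lia|]; apply parts_one; auto; intros _.
    exists i; split; auto; intros i' s Hi' _.
    apply Hin in Hi'; rewrite Hnil in Hi'; destruct Hi' as [->|[]]; lra.
  - set (U := fun s => forall i', In i' l' -> quad (q i) s < quad (q i') s).
    apply parts_weaken with (5 * N + 5)%nat; [lia|].
    eapply parts_mono; [|apply parts_merge;
      [| |apply (IH l' Hlen Hcons)|apply (parts_convex U); auto]].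
    + intros u v _ _ _ [(i0 & Hi0 & Hmin) [HU|HU]].
      * exists i; split; auto; intros i' s Hi' Hs.
        apply Hin in Hi' as [->|Hi']; [lra|].
        apply Rlt_le, HU; auto.
      * exists i0; split; [apply Hin; auto|]; intros i' s Hi' Hs.
        apply Hin in Hi' as [->|Hi']; [|auto].
        (* If [i] were below the minimiser [i0] of the others, it would be below all of them and [s]
           would belong to [U]. *)
        apply Rnot_lt_le; intros Hlt; apply (HU s Hs); intros i' Hi'.
        specialize (Hmin i' s Hi' Hs); lra.
    + apply hereditary_lowest.
    + apply hereditary_decided.
    + intros x y z Hxyz Hx Hz i' Hi'.
      apply (convex_below (q i) (q i')) with x z; auto.
      apply Hmax, Hin; auto.
Qed.

(** * Sign changes of quadratics *)

(** The list holds the isolated real roots. Constants and quadratics of negative discriminant need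
    none, since their sign never changes. *)
Lemma quad_switch c : exists L : list R, (length L <= 2)%nat /\
  forall t t', t < t' -> ~ (quad c t <= 0 <-> quad c t' <= 0) ->
    exists r, In r L /\ t <= r <= t'.
Proof.
  destruct c as [[A B] C]; unfold quad.
  destruct (Req_dec A 0) as [->|HA].
  - destruct (Req_dec B 0) as [->|HB].
    + exists nil; split; [simpl; lia|]; intros t t' _ H; exfalso; apply H.
      replace (0 * t ^ 2 + 0 * t) with (0 * t' ^ 2 + 0 * t') by ring; tauto.
    + exists ((- C / B) :: nil); split; [simpl; lia|].
      set (r := - C / B).
      assert (HC : C = - B * r) by (unfold r; field; auto).
      intros t t' Ht H; exists r; split; [left; auto|].
      apply NNPP; intros Hn; apply H; clearbody r; subst C.
      destruct (Rlt_le_dec r t); [|assert (t' < r) by lra];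
      destruct (Rdichotomy B 0 HB); split; intros; nra.
  - destruct (Rlt_le_dec (B ^ 2 - 4 * A * C) 0) as [Hd|Hd].
    + exists nil; split; [simpl; lia|]; intros t t' _ H; exfalso; apply H.
      (* Completing the square: 4 A times the quadratic is the square of 2 A s + B minus the
         negative discriminant. *)
      assert (forall s, 0 < A * (A * s ^ 2 + B * s + C)).
      { intros s; pose proof (pow2_ge_0 (2 * A * s + B)); nra. }
      destruct (Rdichotomy A 0 HA); split; intros Hq;
        pose proof (H0 t); pose proof (H0 t'); nra.
    + set (w := sqrt (B ^ 2 - 4 * A * C)).
      assert (Hw : w * w = B ^ 2 - 4 * A * C) by (apply sqrt_sqrt; auto).
      set (r1 := (- B - w) / (2 * A)); set (r2 := (- B + w) / (2 * A)).
      assert (Hf : forall s, A * s ^ 2 + B * s + C = A * ((s - r1) * (s - r2))).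
      { intros s; replace C with ((B ^ 2 - w * w) / (4 * A)) by
          (rewrite Hw; field; auto).
        unfold r1, r2; field; auto. }
      exists (r1 :: r2 :: nil); split; [simpl; lia|].
      intros t t' Ht H; apply NNPP; intros Hn; apply H.
      assert (N1 : ~ (t <= r1 <= t')) by (intros ?; apply Hn; exists r1; simpl; auto).
      assert (N2 : ~ (t <= r2 <= t')) by (intros ?; apply Hn; exists r2; simpl; auto).
      rewrite !Hf; clearbody r1 r2; clear - N1 N2 Ht HA.
      assert (0 < (t - r1) * (t' - r1)).
      { destruct (Rlt_le_dec r1 t); [|assert (t' < r1) by lra]; nra. }
      assert (0 < (t - r2) * (t' - r2)).
      { destruct (Rlt_le_dec r2 t); [|assert (t' < r2) by lra]; nra. }
      (* No root lies between [t] and [t'], so each linear factor keeps its sign, and [x] and [y]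
         have the same sign. *)
      set (x := (t - r1) * (t - r2)); set (y := (t' - r1) * (t' - r2)).
      assert (Hxy : 0 < x * y).
      { replace (x * y) with (((t - r1) * (t' - r1)) * ((t - r2) * (t' - r2)))
          by (unfold x, y; ring).
        apply Rmult_lt_0_compat; auto. }
      clearbody x y; split; intros; destruct (Rdichotomy A 0 HA); nra.
Qed.

Lemma nsum_const m k : nsum (fun _ => k) m = (m * k)%nat.
Proof. induction m; simpl; lia. Qed.

(** Each piece contributes its two ends and at most two roots, hence the factor 4. The ends are
    listed because the hypothesis says nothing about [U] at breakpoints. *)
Lemma switch_points (U : R -> Prop) k a b :
  parts (fun u v => exists c, forall s, u < s < v -> (U s <-> quad c s <= 0)) k a b ->
  exists L : list R, (length L <= 4 * k)%nat /\
    forall t t', a <= t -> t < t' -> t' <= b -> ~ (U t <-> U t') ->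
      exists r, In r L /\ t <= r <= t'.
Proof.
  induction 1 as [k a|k a m b Ham [c Hc] H (L & HL & IH)].
  - exists nil; split; [simpl; lia|]; intros; lra.
  - destruct (quad_switch c) as (L' & HL' & Hsw).
    exists (a :: m :: L' ++ L); split; [simpl; rewrite length_app; lia|].
    intros t t' Ht Htt' Ht' Hd.
    destruct (Rle_lt_dec t a); [exists a; split; [left; auto|lra]|].
    destruct (Rle_lt_dec m t') as [Hm|Hm].
    + destruct (Rle_lt_dec t m) as [Hm'|Hm'].
      * exists m; split; [right; left; auto|lra].
      * destruct (IH t t') as (r0 & Hr & Hb); auto; [lra|].
        exists r0; split; auto; do 2 right; apply in_or_app; auto.
    + destruct (Hsw t t') as (r0 & Hr & Hb); auto.
      * rewrite <- !Hc by lra; auto.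
      * exists r0; split; auto; do 2 right; apply in_or_app; auto.
Qed.

Lemma quad_continuity c s : continuity_pt (quad c) s.
Proof. destruct c as [[A B] C]; unfold quad; reg. Qed.

(** Continuity carries the weak inequality to the end points; this is why closeness, unlike its
    negation, extends to closed intervals. *)
Lemma quad_nonpos_closure c x y :
  (forall s, x < s < y -> quad c s <= 0) ->
  forall s, x < y -> x <= s <= y -> quad c s <= 0.
Proof.
  intros H s Hxy Hs; apply Rnot_lt_le; intros Hpos.
  destruct (quad_continuity c s (quad c s) Hpos) as (alp & Halp & Hc).
  simpl in Hc; unfold R_dist in Hc.
  assert (Hu : exists u, x < u < y /\ s <> u /\ Rabs (u - s) < alp).
  { destruct (Rlt_le_dec s y) as [Hsy|Hsy].
    - exists (s + Rmin (alp / 2) ((y - s) / 2)).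
      pose proof (Rmin_l (alp / 2) ((y - s) / 2)).
      pose proof (Rmin_r (alp / 2) ((y - s) / 2)).
      assert (0 < Rmin (alp / 2) ((y - s) / 2)) by (apply Rmin_pos; lra).
      split; [lra|]; split; [lra|]; rewrite Rabs_right; lra.
    - exists (s - Rmin (alp / 2) ((y - x) / 2)).
      pose proof (Rmin_l (alp / 2) ((y - x) / 2)).
      pose proof (Rmin_r (alp / 2) ((y - x) / 2)).
      assert (0 < Rmin (alp / 2) ((y - x) / 2)) by (apply Rmin_pos; lra).
      split; [lra|]; split; [lra|]; rewrite Rabs_left; lra. }
  destruct Hu as (u & Hu1 & Hu2 & Hu3).
  specialize (Hc u); unfold D_x, no_cond in Hc.
  assert (Hd := Hc (conj (conj I Hu2) Hu3)).
  specialize (H u Hu1); apply Rabs_def2 in Hd; lra.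
Qed.

(** * Squared distances and the cost function *)

Fixpoint sqdist_coef (d : nat) (P Q P' Q' : nat -> R) : R * R * R :=
  match d with
  | O => (0, 0, 0)
  | S e => let '(A, B, C) := sqdist_coef e P Q P' Q' in
      (A + (Q e - Q' e) ^ 2, B + 2 * (P e - P' e) * (Q e - Q' e), C + (P e - P' e) ^ 2)
  end.

Lemma sqdist_quad d P Q P' Q' x x' s :
  (forall c, (c < d)%nat -> x c = P c + s * Q c) ->
  (forall c, (c < d)%nat -> x' c = P' c + s * Q' c) ->
  sqdist d x x' = quad (sqdist_coef d P Q P' Q') s.
Proof.
  induction d; intros Hx Hx'; simpl; [ring|].
  rewrite IHd by (intros; auto).
  destruct (sqdist_coef d P Q P' Q') as [[A B] C]; unfold quad.
  rewrite (Hx d), (Hx' d) by lia; ring.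
Qed.

Lemma sqdist_pos d x y : 0 <= sqdist d x y.
Proof. induction d; simpl; [lra|]; pose proof (pow2_ge_0 (x d - y d)); simpl in *; lra. Qed.

Lemma dist_sym d x y : dist d x y = dist d y x.
Proof.
  unfold dist; f_equal; induction d; simpl; auto; rewrite IHd; ring.
Qed.

Lemma dist_le d x y eps : 0 < eps -> (dist d x y <= eps <-> sqdist d x y - eps ^ 2 <= 0).
Proof.
  intros He; unfold dist; pose proof (sqdist_pos d x y); split; intros H'.
  - assert (0 <= sqrt (sqdist d x y)) by apply sqrt_pos.
    rewrite <- (sqrt_sqrt (sqdist d x y)) by auto; simpl; nra.
  - rewrite <- (sqrt_pow2 eps) by lra; apply sqrt_le_1; simpl in *; nra.
Qed.

Lemma Dmax_ge d n sig i s j : (j < n)%nat -> dist d (sig i s) (sig j s) <= Dmax d n sig i s.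
Proof.
  intros Hj; unfold Dmax.
  assert (Hin : In j (seq 0 n)) by (apply in_seq; lia).
  induction (seq 0 n) as [|k l IH]; [easy|]; simpl.
  destruct Hin as [->|Hin]; [apply Rmax_l|].
  eapply Rle_trans; [apply IH; auto|apply Rmax_r].
Qed.

Lemma Dmax_le d n sig i s m : 0 <= m ->
  (forall j, (j < n)%nat -> dist d (sig i s) (sig j s) <= m) -> Dmax d n sig i s <= m.
Proof.
  intros Hm H; unfold Dmax.
  assert (Hin : forall j, In j (seq 0 n) -> (j < n)%nat) by (intros j Hj; apply in_seq in Hj; lia).
  induction (seq 0 n) as [|k l IH]; simpl; auto.
  apply Rmax_lub; [apply H, Hin; left; auto|apply IH; intros; apply Hin; right; auto].
Qed.

(** * Elementary intervals *)

Definition linear_on d n (sig : traj) (x y : R) : Prop :=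
  exists P Q : nat -> nat -> R, forall i s c, (i < n)%nat -> x <= s <= y -> (c < d)%nat ->
    sig i s c = P i c + s * Q i c.

(** Nonnegativity is recorded because [sqrt] sends negative numbers to 0, while comparing two roots
    has to reduce to comparing the quadratics. *)
Definition sqrt_quad_on d n (sig : traj) (i : nat) (x y : R) : Prop :=
  exists c, forall s, x < s < y -> 0 <= quad c s /\ Dmax d n sig i s = sqrt (quad c s).

(** The closed interval in the first case lets connections persist up to the end points; in the
    second case the distance may still drop to [eps] at an end. *)
Definition proximity_decided d (sig : traj) eps (i j : nat) (x y : R) : Prop :=
  (forall s, x <= s <= y -> dist d (sig i s) (sig j s) <= eps) \/
  (forall s, x < s < y -> ~ dist d (sig i s) (sig j s) <= eps).

(** The repeated [linear_on] reflects the nested uses of [parts_all], each of which carries a base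
    predicate. *)
Definition elementary d n (sig : traj) eps (x y : R) : Prop :=
  (linear_on d n sig x y /\ forall i, (i < n)%nat -> sqrt_quad_on d n sig i x y) /\
  forall i, (i < n)%nat -> linear_on d n sig x y /\
    forall j, (j < n)%nat -> proximity_decided d sig eps i j x y.

Lemma hereditary_linear d n sig : hereditary (linear_on d n sig).
Proof.
  intros a b a' b' H1 H2 H3 (P & Q & H); exists P, Q; intros; apply H; auto; lra.
Qed.

Lemma hereditary_sqrt_quad d n sig i : hereditary (sqrt_quad_on d n sig i).
Proof. intros a b a' b' H1 H2 H3 (c & H); exists c; intros; apply H; lra. Qed.

Lemma hereditary_proximity d sig eps i j : hereditary (proximity_decided d sig eps i j).
Proof.
  intros a b a' b' H1 H2 H3 [H|H]; [left|right]; intros; apply H; lra.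
Qed.

Lemma hereditary_elementary d n sig eps : hereditary (elementary d n sig eps).
Proof.
  apply hereditary_and.
  - apply hereditary_and; [apply hereditary_linear|].
    apply hereditary_all; intros; apply hereditary_sqrt_quad.
  - apply (hereditary_all (fun i x y => linear_on d n sig x y /\
      forall j, (j < n)%nat -> proximity_decided d sig eps i j x y)); intros i.
    apply hereditary_and; [apply hereditary_linear|].
    apply hereditary_all; intros; apply hereditary_proximity.
Qed.

Lemma linear_on_edge d n tau tm sig k :
  increasing_times tau tm -> piecewise_linear d n tau tm sig -> (k < tau)%nat ->
  linear_on d n sig (tm k) (tm (S k)).
Proof.
  intros Hinc Hpl Hk; specialize (Hinc k Hk).
  exists (fun i c => sig i (tm k) c
    - tm k / (tm (S k) - tm k) * (sig i (tm (S k)) c - sig i (tm k) c)),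
   (fun i c => (sig i (tm (S k)) c - sig i (tm k) c) / (tm (S k) - tm k)).
  intros i s c Hi Hs Hc; rewrite (Hpl i k Hi Hk s Hs c Hc); field; lra.
Qed.

Lemma linear_sqdist d n sig x y : linear_on d n sig x y ->
  exists c : nat -> nat -> R * R * R, forall i j s, (i < n)%nat -> (j < n)%nat ->
    x <= s <= y -> sqdist d (sig i s) (sig j s) = quad (c i j) s.
Proof.
  intros (P & Q & H).
  exists (fun i j => sqdist_coef d (P i) (Q i) (P j) (Q j)).
  intros; apply sqdist_quad; intros; apply H; auto.
Qed.

(** The square of D is the upper envelope of [n] quadratics, that is, the negated lower envelope of
    their opposites [q]. *)
Lemma parts_sqrt_quad d n sig x y i : x <= y -> (i < n)%nat -> linear_on d n sig x y ->
  parts (sqrt_quad_on d n sig i) (5 * n) x y.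
Proof.
  intros Hxy Hi Hlin; destruct (linear_sqdist _ _ _ _ _ Hlin) as (c & Hc).
  set (q := fun j => let '(A, B, C) := c i j in (- A, - B, - C)).
  assert (Hq : forall j s, quad (q j) s = - quad (c i j) s).
  { intros j s; unfold q; destruct (c i j) as [[A B] C]; unfold quad; ring. }
  replace (5 * n)%nat with (5 * length (seq 0 n))%nat by (rewrite length_seq; auto).
  eapply parts_mono; [|apply (parts_lowest q (seq 0 n)); auto].
  - intros u v Hu Huv Hv (m & Hm & Hmin); apply in_seq in Hm.
    exists (c i m); intros s Hs.
    rewrite <- Hc by (try lia; try lra); split; [apply sqdist_pos|].
    apply Rle_antisym; [apply Dmax_le; [apply sqrt_pos|]|apply (Dmax_ge d n sig i s m); lia].
    intros j Hj; apply sqrt_le_1_alt; rewrite !Hc by (try lia; try lra).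
    specialize (Hmin j s); rewrite !Hq in Hmin.
    rewrite in_seq in Hmin; assert (0 <= j < 0 + n)%nat by lia.
    specialize (Hmin H Hs); lra.
  - destruct n; [lia|easy].
Qed.

(** Closeness is the condition that squared distance minus [eps ^ 2] is at most 0; it changes only
    at the at most two roots. *)
Lemma parts_proximity d n sig eps x y i j : 0 < eps -> x <= y ->
  (i < n)%nat -> (j < n)%nat -> linear_on d n sig x y ->
  parts (proximity_decided d sig eps i j) 5 x y.
Proof.
  intros He Hxy Hi Hj Hlin; destruct (linear_sqdist _ _ _ _ _ Hlin) as (c & Hc).
  set (q := let '(A, B, C) := c i j in (A, B, C - eps ^ 2)).
  assert (Hq : forall s, x <= s <= y ->
    (dist d (sig i s) (sig j s) <= eps <-> quad q s <= 0)).
  { intros s Hs; rewrite dist_le, (Hc i j s) by auto; unfold q.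
    destruct (c i j) as [[A B] C]; unfold quad; split; lra. }
  destruct (quad_switch q) as (L & HL & Hsw).
  apply parts_weaken with (2 * length L + 1)%nat; [lia|].
  eapply parts_mono; [|apply (parts_avoids L); auto].
  intros u v Hu Huv Hv Hav.
  assert (Hsame : forall t t', u < t < v -> u < t' < v -> quad q t <= 0 -> quad q t' <= 0).
  { assert (Hlt : forall t t', u < t -> t < t' -> t' < v -> (quad q t <= 0 <-> quad q t' <= 0)).
    { intros t t' ? ? ?; apply NNPP; intros Hn.
      destruct (Hsw t t') as (r & Hr & Hb); auto; apply (Hav r Hr); lra. }
    intros t t' Ht Ht' H; destruct (Rtotal_order t t') as [?|[->|?]]; auto.
    - apply (Hlt t t'); auto; lra.
    - apply (Hlt t' t); auto; lra. }
  destruct (classic (exists s, u < s < v /\ quad q s <= 0)) as [(s & Hs & Hqs)|Hn].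
  - left; intros s' Hs'; apply Hq; [lra|].
    apply (quad_nonpos_closure q u v); auto; intros; apply (Hsame s); auto.
  - right; intros s Hs H; apply Hn; exists s; split; auto; apply Hq; auto; lra.
Qed.

Lemma parts_edges P m tau tm : (forall k, (k < tau)%nat -> parts P m (tm k) (tm (S k))) ->
  parts P (tau * m) (tm 0%nat) (tm tau).
Proof. rewrite <- nsum_const; intros; apply parts_concat; auto. Qed.

Lemma parts_sqrt_quad_all d n tau tm sig i :
  increasing_times tau tm -> piecewise_linear d n tau tm sig -> (i < n)%nat ->
  parts (sqrt_quad_on d n sig i) (tau * (5 * n)) (tm 0%nat) (tm tau).
Proof.
  intros Hinc Hpl Hi; apply parts_edges; intros k Hk.
  apply parts_sqrt_quad; auto; [apply Rlt_le; auto|eapply linear_on_edge; eauto].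
Qed.

Lemma parts_elementary d n tau tm sig eps : 0 < eps -> (1 <= n)%nat ->
  increasing_times tau tm -> piecewise_linear d n tau tm sig ->
  parts (elementary d n sig eps) (12 * n * n * tau) (tm 0%nat) (tm tau).
Proof.
  intros He Hn Hinc Hpl.
  assert (Hlin : parts (linear_on d n sig) (tau * 1) (tm 0%nat) (tm tau)).
  { apply parts_edges; intros k Hk; apply parts_one; [apply Rlt_le; auto|].
    intros _; eapply linear_on_edge; eauto. }
  set (m1 := (tau * 1 + n * (tau * (5 * n)))%nat).
  set (m2 := (tau * 1 + n * (tau * 5))%nat).
  (* The total is tau (1 + n + 10 n^2), at most 12 n^2 tau because n is at least 1. *)
  apply parts_weaken with (m1 + n * m2)%nat; [unfold m1, m2; nia|].
  apply (parts_all (fun x y => linear_on d n sig x y /\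
      forall i, (i < n)%nat -> sqrt_quad_on d n sig i x y)
    (fun i x y => linear_on d n sig x y /\
      forall j, (j < n)%nat -> proximity_decided d sig eps i j x y)).
  - apply hereditary_and; [apply hereditary_linear|].
    apply hereditary_all; intros; apply hereditary_sqrt_quad.
  - intros i; apply hereditary_and; [apply hereditary_linear|].
    apply hereditary_all; intros; apply hereditary_proximity.
  - apply (parts_all (linear_on d n sig) (sqrt_quad_on d n sig)); auto.
    + apply hereditary_linear.
    + intros; apply hereditary_sqrt_quad.
    + intros; apply parts_sqrt_quad_all; auto.
  - intros i Hi; apply (parts_all (linear_on d n sig) (proximity_decided d sig eps i)); auto.
    + apply hereditary_linear.
    + intros; apply hereditary_proximity.
    + intros j Hj; apply parts_edges; intros k Hk.
      apply parts_proximity with n; auto; [apply Rlt_le; auto|eapply linear_on_edge; eauto].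
Qed.

(** On a common refinement of 10 n tau pieces both values are roots of quadratics, and their order
    is the sign of the difference of these; [switch_points] gives 4 points per piece. *)
Lemma Dmax_switches d n tau tm sig i j :
  increasing_times tau tm -> piecewise_linear d n tau tm sig ->
  (i < n)%nat -> (j < n)%nat ->
  exists L : list R, (length L <= 40 * n * tau)%nat /\
    forall t t', tm 0%nat <= t -> t < t' -> t' <= tm tau ->
      ~ (Dmax d n sig i t <= Dmax d n sig j t <-> Dmax d n sig i t' <= Dmax d n sig j t') ->
      exists r, In r L /\ t <= r <= t'.
Proof.
  intros Hinc Hpl Hi Hj.
  destruct (switch_points (fun t => Dmax d n sig i t <= Dmax d n sig j t)
    (tau * (5 * n) + tau * (5 * n)) (tm 0%nat) (tm tau)) as (L & HL & Hsw).
  - eapply parts_mono; [|apply (parts_merge (sqrt_quad_on d n sig i) (sqrt_quad_on d n sig j));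
      try apply hereditary_sqrt_quad; apply parts_sqrt_quad_all; auto].
    intros u v _ _ _ [(c & Hc) (c' & Hc')].
    destruct c as [[A B] C], c' as [[A' B'] C'].
    exists (A - A', B - B', C - C'); intros s Hs.
    destruct (Hc s Hs) as [Hp ->], (Hc' s Hs) as [Hp' ->].
    replace (quad (A - A', B - B', C - C') s) with (quad (A, B, C) s - quad (A', B', C') s)
      by (unfold quad; ring).
    split; intros H; [|apply sqrt_le_1_alt; lra].
    apply sqrt_le_0 in H; lra.
  - exists L; split; auto; lia.
Qed.

(** * Connectivity and trajectoids on an elementary interval *)

Lemma eps_connected_lt d n sig eps s i j :
  eps_connected d n sig eps s i j -> (i < n)%nat /\ (j < n)%nat.
Proof. induction 1; intuition. Qed.

Lemma eps_connected_trans d n sig eps s i j k :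
  eps_connected d n sig eps s i j -> eps_connected d n sig eps s j k ->
  eps_connected d n sig eps s i k.
Proof. induction 1; auto; intros; eapply ec_step; eauto. Qed.

Lemma eps_connected_sym d n sig eps s i j :
  eps_connected d n sig eps s i j -> eps_connected d n sig eps s j i.
Proof.
  induction 1 as [|i j k Hi Hj Hd H IH]; [constructor; auto|].
  eapply eps_connected_trans; [exact IH|].
  apply ec_step with i; auto; [rewrite dist_sym; auto|constructor; auto].
Qed.

(** Every link of the chain is close at the interior time [u], so its proximity is decided
    positively and it survives on the whole closed interval. *)
Lemma elementary_connected d n sig eps x y u s i j :
  elementary d n sig eps x y -> x < u < y -> x <= s <= y ->
  eps_connected d n sig eps u i j -> eps_connected d n sig eps s i j.
Proof.
  intros [_ Hel] Hu Hs; induction 1 as [|i j k Hi Hj Hd H IH]; [constructor; auto|].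
  eapply ec_step; eauto.
  destruct (proj2 (Hel i Hi) j Hj) as [Hc|Hf]; auto.
  exfalso; apply (Hf u Hu Hd).
Qed.

(** Connectedness of an interval by a supremum argument; it turns the local condition on trajectoids
    into a global one. *)
Lemma locally_constant_interval (F : R -> Prop) a b : a <= b ->
  (forall s, a <= s <= b -> exists delta, delta > 0 /\
     forall u, a <= u <= b -> Rabs (u - s) < delta -> (F s <-> F u)) ->
  F a -> F b.
Proof.
  intros Hab Hloc Ha.
  set (E := fun x => a <= x <= b /\ forall w, a <= w <= x -> F w).
  assert (HEa : E a).
  { split; [lra|]; intros w Hw; replace w with a by lra; auto. }
  destruct (completeness E) as (m & Hm1 & Hm2).
  { exists b; intros x [Hx _]; lra. }
  { exists a; auto. }
  assert (Hma : a <= m) by (apply Hm1; auto).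
  assert (Hmb : m <= b) by (apply Hm2; intros x [Hx _]; lra).
  destruct (Hloc m) as (delta & Hd & Hl); [lra|].
  assert (Hx : exists x, E x /\ m - delta < x).
  { apply NNPP; intros HC; assert (m <= m - delta); [|lra].
    apply Hm2; intros x Hx; apply Rnot_lt_le; intros ?; apply HC; eauto. }
  destruct Hx as (x & [Hx HF] & Hxm).
  assert (x <= m) by (apply Hm1; split; auto).
  assert (HFm : F m).
  { apply (Hl x); [lra|rewrite Rabs_left1; lra|apply HF; lra]. }
  (* [F] holds up to [z], which exceeds the supremum [m] unless [m = b]. *)
  set (z := Rmin b (m + delta / 2)).
  assert (Hz1 : z <= b) by apply Rmin_l.
  assert (Hz2 : z <= m + delta / 2) by apply Rmin_r.
  assert (HEz : E z).
  { split; [split; auto; apply Rmin_glb; lra|].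
    intros w Hw; destruct (Rle_lt_dec w x); [apply HF; lra|].
    apply (Hl w); auto; [lra|apply Rabs_def1; lra]. }
  assert (Hzm : z <= m) by (apply Hm1; auto).
  unfold z, Rmin in Hzm; destruct (Rle_dec b (m + delta / 2)); [|lra].
  replace b with m by lra; auto.
Qed.

(** Components do not change inside the interval, and near each time a trajectoid stays in one
    component, so the component it uses is locally constant. *)
Lemma trajectoid_connected d n tau tm sig eps T x y :
  trajectoid d n tau tm sig eps T -> elementary d n sig eps x y ->
  tm 0%nat <= x -> y <= tm tau ->
  forall s u, x < s < y -> x < u < y -> eps_connected d n sig eps s (T s) (T u).
Proof.
  intros [HT1 HT2] Hel Hx Hy.
  assert (Hle : forall s u, x < s -> s <= u -> u < y ->
    eps_connected d n sig eps s (T s) (T u)).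
  { intros s u Hs Hsu Hu.
    apply (locally_constant_interval
      (fun w => eps_connected d n sig eps s (T s) (T w)) s u Hsu);
      [|constructor; apply HT1; lra].
    intros w Hw; destruct (HT2 w) as (delta & Hd & Hc); [lra|].
    exists delta; split; auto; intros v Hv Hvw.
    assert (Hwv : eps_connected d n sig eps s (T w) (T v)).
    { apply (elementary_connected d n sig eps x y w); auto; try lra.
      apply Hc; auto; lra. }
    split; intros H; eapply eps_connected_trans; eauto.
    apply eps_connected_sym; auto. }
  intros s u Hs Hu; destruct (Rle_lt_dec s u); [apply Hle; lra|].
  apply (elementary_connected d n sig eps x y u); auto; try lra.
  apply eps_connected_sym, Hle; lra.
Qed.

(** * Irreducible sets and double counting *)

(** Discard, one at a time, any entity that at every time is matched or beaten by another remaining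
    one. When none is left to discard, each survivor is strictly lowest at some time. *)
Lemma irreducible_subset (D : nat -> R -> R) (l : list nat) x y : NoDup l ->
  exists S : list nat, NoDup S /\ incl S l /\
    (forall i s, In i l -> x < s < y -> exists e, In e S /\ D e s <= D i s) /\
    forall i, In i S -> exists s, x < s < y /\
      forall i', In i' S -> i' <> i -> D i s < D i' s.
Proof.
  remember (length l) as N eqn:HN; revert l HN.
  induction N as [N IH] using lt_wf_ind; intros l HN Hnd.
  destruct (classic (exists i, In i l /\ forall s, x < s < y ->
    exists i', In i' l /\ i' <> i /\ D i' s <= D i s)) as [(i & Hi & Hr)|Hirr].
  - assert (Hnd' : NoDup (remove Nat.eq_dec i l)) by
      (rewrite <- remove_alt; apply NoDup_filter; auto).
    destruct (IH (length (remove Nat.eq_dec i l))) with (remove Nat.eq_dec i l)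
      as (S & HS1 & HS2 & HS3 & HS4); auto.
    { subst N; apply remove_length_lt; auto. }
    exists S; split; [auto|split; [|split; auto]].
    + intros e He; apply HS2, in_remove in He; tauto.
    + intros e s He Hs; destruct (Nat.eq_dec e i) as [->|Hne].
      * destruct (Hr s Hs) as (i' & Hi' & Hne & Hle).
        destruct (HS3 i' s) as (e & HeS & Hes); auto; [apply in_in_remove; auto|].
        exists e; split; auto; lra.
      * apply HS3; auto; apply in_in_remove; auto.
  - exists l; split; [auto|split; [apply incl_refl|split]].
    + intros e s He Hs; exists e; split; auto; lra.
    + intros i Hi; apply NNPP; intros Hn; apply Hirr; exists i; split; auto.
      intros s Hs; apply NNPP; intros Hn'; apply Hn; exists s; split; auto.
      intros i' Hi' Hne; apply Rnot_le_lt; intros Hle; apply Hn'; eauto.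
Qed.

Lemma nsum_le f g m : (forall j, (j < m)%nat -> (f j <= g j)%nat) ->
  (nsum f m <= nsum g m)%nat.
Proof.
  induction m; intros H; simpl; [lia|].
  assert (nsum f m <= nsum g m)%nat by auto.
  specialize (H m); lia.
Qed.

Lemma nsum_add f g m : nsum (fun j => f j + g j)%nat m = (nsum f m + nsum g m)%nat.
Proof. induction m; simpl; lia. Qed.

Lemma nsum_scal k f m : nsum (fun j => k * f j)%nat m = (k * nsum f m)%nat.
Proof. induction m; simpl; lia. Qed.

Lemma nsum_ext f g m : (forall j, (j < m)%nat -> f j = g j) -> nsum f m = nsum g m.
Proof. induction m; intros H; simpl; auto; rewrite IHm, (H m); auto. Qed.

Lemma nsum_exchange (f : nat -> nat -> nat) m k :
  nsum (fun i => nsum (f i) k) m = nsum (fun j => nsum (fun i => f i j) m) k.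
Proof.
  induction m; simpl.
  - induction k; simpl; lia.
  - rewrite IHm, <- nsum_add; auto.
Qed.

Lemma nsum_indicator (f : nat -> nat) i m : (i < m)%nat ->
  nsum (fun j => if Nat.eq_dec i j then f j else 0%nat) m = f i.
Proof.
  intros Hi; induction m; [lia|]; simpl.
  destruct (Nat.eq_dec i m) as [->|Hne]; [|rewrite IHm; lia].
  rewrite (nsum_ext _ (fun _ => 0%nat)); [rewrite nsum_const; lia|].
  intros j Hj; destruct (Nat.eq_dec m j); lia.
Qed.

Lemma length_le_nsum (l : list nat) n : NoDup l -> (forall i, In i l -> (i < n)%nat) ->
  (length l <= nsum (fun i => if in_dec Nat.eq_dec i l then 1 else 0) n)%nat.
Proof.
  intros Hnd Hl.
  set (b := fun i => if in_dec Nat.eq_dec i l then true else false).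
  assert (Hf : length (filter b (seq 0 n)) =
    nsum (fun i => if in_dec Nat.eq_dec i l then 1 else 0)%nat n).
  { clear Hl; induction n; auto; rewrite seq_S, filter_app, length_app, IHn; simpl.
    unfold b; destruct (in_dec Nat.eq_dec n l); reflexivity. }
  rewrite <- Hf; apply NoDup_incl_length; auto.
  intros i Hi; apply filter_In; split; [apply in_seq; specialize (Hl i Hi); lia|].
  unfold b; destruct (in_dec Nat.eq_dec i l); auto.
Qed.

(** Each marked interval owns a point of [L]. The point of the last interval lies beyond all earlier
    ones, so it can be removed before the induction. *)
Lemma disjoint_intervals_count (f : nat -> nat) (p : nat -> R) M (L : list R) :
  (forall j, (j < M)%nat -> p j < p (S j)) ->
  (forall j, (j < M)%nat -> (f j <= 1)%nat) ->
  (forall j, (j < M)%nat -> f j <> 0%nat -> exists r, In r L /\ p j < r < p (S j)) ->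
  (nsum f M <= length L)%nat.
Proof.
  revert L; induction M as [|M IH]; intros L Hp Hf HL; simpl; [lia|].
  assert (Hmono : forall j, (j < M)%nat -> p (S j) <= p M).
  { intros j Hj; clear - Hp Hj; induction M; [lia|].
    destruct (Nat.eq_dec j M) as [->|]; [lra|].
    apply Rle_trans with (p M); [apply IHM; auto; lia|apply Rlt_le, Hp; lia]. }
  destruct (Nat.eq_dec (f M) 0) as [H0|H0].
  - rewrite H0, Nat.add_0_r; apply IH; auto.
  - destruct (HL M) as (r & Hr & Hb); auto.
    destruct (in_split _ _ Hr) as (L1 & L2 & ->).
    assert (nsum f M <= length (L1 ++ L2))%nat.
    { apply IH; auto; intros j Hj Hfj.
      destruct (HL j) as (r' & Hr' & Hb'); auto; exists r'; split; auto.
      specialize (Hmono j Hj).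
      apply in_app_iff in Hr'; apply in_app_iff.
      destruct Hr' as [?|[<-|?]]; auto; lra. }
    specialize (Hf M (Nat.lt_succ_diag_r M)).
    rewrite length_app in *; simpl; lia.
Qed.

(** Expand each square over ordered pairs: a diagonal term is at most [f j i] since the values are 0
    or 1, and each off-diagonal pair contributes at most [K]. *)
Lemma pair_count (f : nat -> nat -> nat) M n K :
  (forall j i, (f j i <= 1)%nat) ->
  (forall i i', (i < n)%nat -> (i' < n)%nat -> i <> i' ->
     (nsum (fun j => f j i * f j i') M <= K)%nat) ->
  (nsum (fun j => nsum (f j) n * nsum (f j) n) M
    <= nsum (fun j => nsum (f j) n) M + n * (n * K))%nat.
Proof.
  intros Hf HK.
  rewrite (nsum_ext (fun j => nsum (f j) n * nsum (f j) n)%nat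
    (fun j => nsum (fun i => nsum (fun i' => f j i * f j i') n) n)%nat).
  2: { intros j _; rewrite <- nsum_scal; apply nsum_ext; intros i _.
       rewrite nsum_scal; lia. }
  rewrite nsum_exchange, (nsum_exchange (fun j i => f j i)).
  rewrite <- (nsum_const n (n * K)), <- nsum_add.
  apply nsum_le; intros i Hi; rewrite nsum_exchange.
  (* The diagonal contribution is spread over [i'] by an indicator, so that the bound can be checked
     term by term. *)
  rewrite <- (nsum_indicator (fun i => nsum (fun j => f j i) M) i n Hi).
  rewrite <- (nsum_const n K), <- nsum_add.
  apply nsum_le; intros i' Hi'.
  destruct (Nat.eq_dec i i') as [<-|Hne]; [|rewrite Nat.add_0_l; auto].
  apply Nat.le_trans with (nsum (fun j => f j i) M); [|lia].
  apply nsum_le; intros j _; specialize (Hf j i); nia.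
Qed.

(** Termwise this is the nonnegativity of the square of x - r. *)
Lemma nsum_am_gm (x : nat -> nat) M r :
  2 * r * INR (nsum x M) <= INR (nsum (fun j => x j * x j)%nat M) + r ^ 2 * INR M.
Proof.
  induction M; [simpl; lra|].
  rewrite S_INR; cbn [nsum]; rewrite !plus_INR, mult_INR.
  pose proof (pow2_ge_0 (INR (x M) - r)); nra.
Qed.

(** * Selections, finite minimisation and integrals *)

Lemma list_of_pred (U : nat -> Prop) n :
  exists l, NoDup l /\ forall i, In i l <-> (i < n)%nat /\ U i.
Proof.
  induction n as [|n (l & Hnd & Hl)].
  - exists nil; split; [constructor|]; simpl; intros; lia.
  - destruct (classic (U n)) as [HU|HU].
    + exists (n :: l); split.
      * constructor; auto; rewrite Hl; lia.
      * intros i; simpl; rewrite Hl; split; [intros [<-|[]]; auto|].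
        intros [Hi HUi]; destruct (Nat.eq_dec n i); auto; right; split; auto; lia.
    + exists l; split; auto; intros i; rewrite Hl; split; [intros []; auto|].
      intros [Hi HUi]; split; auto; destruct (Nat.eq_dec i n) as [->|]; [tauto|lia].
Qed.

(** Glues the witnesses of the open pieces into one function; at the breakpoints a value comes from
    the pointwise existence hypothesis. *)
Lemma select_pieces (U : nat -> R -> Prop) (G : R -> R -> Prop) k a b :
  (forall s, a <= s <= b -> exists e, U e s) ->
  parts (fun u v => (exists e, forall s, u < s < v -> U e s) /\ G u v) k a b ->
  exists T : R -> nat, (forall s, a <= s <= b -> U (T s) s) /\
    parts (fun u v => (exists e, forall s, u < s < v -> T s = e) /\ G u v) k a b.
Proof.
  intros Hex H; revert Hex; induction H as [k a|k a m b Ham [[e He] HG] H IH]; intros Hex.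
  - destruct (Hex a) as [e He]; [lra|].
    exists (fun _ => e); split; [|constructor].
    intros s Hs; replace s with a by lra; auto.
  - pose proof (parts_le _ _ _ _ H) as Hmb.
    destruct IH as (T & HT & Hp); [intros; apply Hex; lra|].
    destruct (Hex a) as [e0 He0]; [lra|].
    exists (fun s => if Rle_dec s a then e0 else if Rlt_dec s m then e else T s).
    split.
    + intros s Hs; destruct (Rle_dec s a); [replace s with a by lra; auto|].
      destruct (Rlt_dec s m); [apply He; lra|apply HT; lra].
    + apply parts_cons with m; auto.
      * split; auto; exists e; intros s Hs.
        destruct (Rle_dec s a); [lra|]; destruct (Rlt_dec s m); [auto|lra].
      * eapply parts_mono; [|exact Hp].
        intros u v Hu Huv Hv [[e' He'] HG']; split; auto; exists e'; intros s Hs.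
        destruct (Rle_dec s a); [lra|]; destruct (Rlt_dec s m); [lra|auto].
Qed.

(** [B] may be infinite, so one witness per [x] is compared and the conclusion provides its own
    [b'']. For best selections along one path this loses nothing: their costs agree inside every
    interval. *)
Lemma finite_min {A B : Type} (l : list A) (Q : A -> B -> Prop) (V : B -> R) :
  (exists x b, In x l /\ Q x b) ->
  exists x b, In x l /\ Q x b /\
    forall x' b', In x' l -> Q x' b' -> exists b'', Q x' b'' /\ V b <= V b''.
Proof.
  induction l as [|x l IH]; [intros (? & ? & [] & _)|intros Hex].
  destruct (classic (exists x b, In x l /\ Q x b)) as [Hl|Hl].
  - destruct (IH Hl) as (y & b & Hy & Hb & Hmin).
    destruct (classic (exists b', Q x b' /\ V b' < V b)) as [(b' & Hb' & Hlt)|Hn].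
    + exists x, b'; split; [left; auto|split; auto].
      intros x' c [<-|Hx'] Hc; [exists b'; split; auto; lra|].
      destruct (Hmin x' c Hx' Hc) as (c' & Hc' & Hle); exists c'; split; auto; lra.
    + exists y, b; split; [right; auto|split; auto].
      intros x' c [<-|Hx'] Hc; [|eauto].
      exists c; split; auto; apply Rnot_lt_le; intros ?; apply Hn; eauto.
  - destruct Hex as (y & b & [<-|Hy] & Hb); [|exfalso; eauto].
    exists x, b; split; [left; auto|split; auto].
    intros x' c [<-|Hx'] Hc; [exists b; split; auto; lra|exfalso; eauto].
Qed.

Fixpoint words (n m : nat) : list (list nat) :=
  match m with
  | O => nil :: nil
  | S m' => flat_map (fun w => map (fun x => x :: w) (seq 0 n)) (words n m')
  end.

Lemma in_words n (w : list nat) : (forall x, In x w -> (x < n)%nat) ->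
  In w (words n (length w)).
Proof.
  induction w as [|x w IH]; intros H; [left; auto|].
  simpl; apply in_flat_map; exists w; split; [apply IH; intros; apply H; right; auto|].
  apply in_map_iff; exists x; split; auto; apply in_seq.
  specialize (H x (or_introl eq_refl)); lia.
Qed.

(** The inequality is known on open pieces only, so the integrals are split at the breakpoints,
    whose values do not matter. *)
Lemma RInt_le_pieces (f g : R -> R) (p : nat -> R) M :
  (forall j, (j < M)%nat -> p j < p (S j)) ->
  ex_RInt f (p 0%nat) (p M) -> ex_RInt g (p 0%nat) (p M) ->
  (forall j s, (j < M)%nat -> p j < s < p (S j) -> f s <= g s) ->
  RInt f (p 0%nat) (p M) <= RInt g (p 0%nat) (p M).
Proof.
  intros Hp; induction M as [|M IH]; intros Hf Hg Hle; [rewrite !RInt_point; lra|].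
  assert (HpM : p M < p (S M)) by auto.
  assert (Hp0 : p 0%nat <= p M).
  { clear - Hp; induction M; [lra|]; apply Rle_trans with (p M); [auto|].
    apply Rlt_le, Hp; lia. }
  assert (Hf1 : ex_RInt f (p 0%nat) (p M)) by
    (apply (@ex_RInt_Chasles_1 R_CompleteNormedModule) with (p (S M)); auto; lra).
  assert (Hf2 : ex_RInt f (p M) (p (S M))) by
    (apply (@ex_RInt_Chasles_2 R_CompleteNormedModule) with (p 0%nat); auto; lra).
  assert (Hg1 : ex_RInt g (p 0%nat) (p M)) by
    (apply (@ex_RInt_Chasles_1 R_CompleteNormedModule) with (p (S M)); auto; lra).
  assert (Hg2 : ex_RInt g (p M) (p (S M))) by
    (apply (@ex_RInt_Chasles_2 R_CompleteNormedModule) with (p 0%nat); auto; lra).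
  rewrite <- (RInt_Chasles f (p 0%nat) (p M) (p (S M))) by auto.
  rewrite <- (RInt_Chasles g (p 0%nat) (p M) (p (S M))) by auto.
  assert (H1 : RInt f (p 0%nat) (p M) <= RInt g (p 0%nat) (p M)) by
    (apply IH; auto; intros j s Hj; apply (Hle j s); lia).
  assert (H2 : RInt f (p M) (p (S M)) <= RInt g (p M) (p (S M))) by
    (apply RInt_le; auto; [lra|intros s Hs; apply (Hle M s); auto]).
  exact (Rplus_le_compat _ _ _ _ H1 H2).
Qed.

Lemma cost_ex_RInt d n sig eps T k a b :
  (forall s, a <= s <= b -> (T s < n)%nat) ->
  parts (fun u v => (exists e, forall s, u < s < v -> T s = e) /\
    elementary d n sig eps u v) k a b ->
  ex_RInt (cost d n sig T) a b.
Proof.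
  intros HT H; revert HT; induction H as [k a|k a m b Ham [[e He] [[_ HD] _]] H IH]; intros HT.
  - apply ex_RInt_point.
  - pose proof (parts_le _ _ _ _ H) as Hmb.
    apply ex_RInt_Chasles with m; [|apply IH; intros; apply HT; lra].
    assert (Hen : (e < n)%nat).
    { rewrite <- (He ((a + m) / 2)) by lra; apply HT; lra. }
    destruct (HD e Hen) as (c & Hc).
    apply ex_RInt_ext with (fun s => sqrt (quad c s)).
    + intros s; rewrite Rmin_left, Rmax_right by lra; intros Hs.
      unfold cost; rewrite He by auto; symmetry; apply Hc; auto.
    + apply (@ex_RInt_continuous R_CompleteNormedModule); intros s _; apply continuous_sqrt_comp.
      apply continuity_pt_filterlim, quad_continuity.
Qed.

(** * Paths of components over a fixed elementary partition *)

Section ElementaryPartition.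

Variables (d n : nat) (sig : traj) (eps : R) (M : nat) (p : nat -> R).
Hypothesis p_step : forall j, (j < M)%nat -> p j < p (S j).
Hypothesis p_elementary : forall j, (j < M)%nat ->
  elementary d n sig eps (p j) (p (S j)).

Notation conn := (eps_connected d n sig eps).
Notation D := (Dmax d n sig).

Lemma breaks_lt i j : (i < j)%nat -> (j <= M)%nat -> p i < p j.
Proof.
  intros Hij; induction Hij as [|j Hij IH]; intros HM; [apply p_step; lia|].
  apply Rlt_trans with (p j); [apply IH; lia|apply p_step; lia].
Qed.

Lemma breaks_le i j : (i <= j)%nat -> (j <= M)%nat -> p i <= p j.
Proof.
  intros Hij HM; destruct (Nat.eq_dec i j) as [->|]; [lra|].
  apply Rlt_le, breaks_lt; lia.
Qed.

Lemma breaks_open_unique i j s : (i < M)%nat -> (j < M)%nat ->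
  p i < s < p (S i) -> p j < s < p (S j) -> i = j.
Proof.
  intros Hi Hj Hs Hs'; destruct (Nat.lt_total i j) as [H|[H|H]]; auto.
  - pose proof (breaks_le (S i) j); specialize (H0 ltac:(lia) ltac:(lia)); lra.
  - pose proof (breaks_le (S j) i); specialize (H0 ltac:(lia) ltac:(lia)); lra.
Qed.

Lemma breaks_not_open i j : (i <= M)%nat -> (j < M)%nat -> ~ p j < p i < p (S j).
Proof.
  intros Hi Hj Hs; destruct (Nat.le_gt_cases i j) as [H|H].
  - pose proof (breaks_le i j H ltac:(lia)); lra.
  - pose proof (breaks_le (S j) i ltac:(lia) ltac:(lia)); lra.
Qed.

Lemma breaks_inj i j : (i <= M)%nat -> (j <= M)%nat -> p i = p j -> i = j.
Proof.
  intros Hi Hj He; destruct (Nat.lt_total i j) as [H|[H|H]]; auto.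
  - pose proof (breaks_lt i j H Hj); lra.
  - pose proof (breaks_lt j i H Hi); lra.
Qed.

Lemma breaks_locate s : p 0%nat <= s <= p M ->
  (exists j, (j <= M)%nat /\ s = p j) \/ (exists j, (j < M)%nat /\ p j < s < p (S j)).
Proof.
  clear p_elementary; induction M as [|m IH]; intros Hs.
  - left; exists 0%nat; split; [lia|lra].
  - destruct (Rle_lt_dec s (p m)) as [Hsm|Hsm].
    + destruct IH as [(j & Hj & He)|(j & Hj & He)]; [intros; apply p_step; lia|lra| |].
      * left; exists j; split; auto.
      * right; exists j; split; auto.
    + destruct (Req_dec s (p (S m))) as [He|He].
      * left; exists (S m); split; auto.
      * right; exists m; split; [lia|lra].
Qed.

Lemma breaks_isolated s : exists delta, delta > 0 /\
  forall j, (j <= M)%nat -> p j <> s -> delta <= Rabs (p j - s).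
Proof.
  clear p_step p_elementary.
  induction M as [|m (delta & Hd & IH)].
  - destruct (Req_dec (p 0%nat) s) as [He|He].
    + exists 1; split; [lra|]; intros j Hj; replace j with 0%nat by lia; tauto.
    + exists (Rabs (p 0%nat - s)); split; [apply Rabs_pos_lt; lra|].
      intros j Hj _; replace j with 0%nat by lia; lra.
  - destruct (Req_dec (p (S m)) s) as [He|He].
    + exists delta; split; auto; intros j Hj Hne.
      destruct (Nat.eq_dec j (S m)) as [->|]; [tauto|apply IH; auto; lia].
    + exists (Rmin delta (Rabs (p (S m) - s))); split.
      * apply Rmin_pos; auto; apply Rabs_pos_lt; lra.
      * intros j Hj Hne; destruct (Nat.eq_dec j (S m)) as [->|]; [apply Rmin_r|].
        eapply Rle_trans; [apply Rmin_l|apply IH; auto; lia].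
Qed.

(* The value [a j] of a path is used at [p j], and its component on the
   following open interval. *)
Definition path (a : nat -> nat) : Prop :=
  (forall j, (j <= M)%nat -> (a j < n)%nat) /\
  (forall j, (j < M)%nat -> conn (p (S j)) (a j) (a (S j))).

(** A relation, since the minimiser need not be unique. At a breakpoint the entity is forced to be
    [a j], so the link condition of [path] governs the passage between intervals. *)
Definition best (a : nat -> nat) (e : nat) (s : R) : Prop :=
  (forall j, (j < M)%nat -> p j < s < p (S j) ->
     conn s (a j) e /\ forall i, conn s (a j) i -> D e s <= D i s) /\
  (forall j, (j <= M)%nat -> s = p j -> e = a j).

Lemma best_exists a s : path a -> p 0%nat <= s <= p M -> exists e, best a e s.
Proof.
  intros [Ha _] Hs; destruct (breaks_locate s Hs) as [(j & Hj & ->)|(j & Hj & Hsj)].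
  - exists (a j); split.
    + intros i Hi H; exfalso; apply (breaks_not_open j i); auto.
    + intros i Hi He; f_equal; apply breaks_inj; auto.
  - destruct (list_of_pred (conn s (a j)) n) as (l & _ & Hl).
    destruct (exists_max (fun i => - D i s) l) as (e & He & Hmin).
    { intros ->; apply (proj2 (Hl (a j))).
      assert (a j < n)%nat by (apply Ha; lia); split; auto; constructor; auto. }
    exists e; split.
    + intros i Hi H; assert (i = j) as -> by (apply (breaks_open_unique i j s); auto).
      split; [apply Hl; auto|]; intros k Hk.
      assert (Hkl : In k l) by (apply Hl; split; auto; apply eps_connected_lt in Hk; tauto).
      specialize (Hmin k Hkl); lra.
    + intros i Hi ->; exfalso; apply (breaks_not_open i j); auto.
Qed.

Lemma best_lt a e s : path a -> p 0%nat <= s <= p M -> best a e s -> (e < n)%nat.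
Proof.
  intros [Ha _] Hs [H1 H2]; destruct (breaks_locate s Hs) as [(j & Hj & He)|(j & Hj & Hsj)].
  - rewrite (H2 j Hj He); auto.
  - destruct (H1 j Hj Hsj) as [Hc _]; apply eps_connected_lt in Hc; tauto.
Qed.

(** A time [u] near [s] is [s] itself or lies in an open interval whose closure contains [s]; there
    [T s] and [T u] are both connected to [a j] at time [s]. *)
Lemma best_trajectoid a T : path a ->
  (forall s, p 0%nat <= s <= p M -> best a (T s) s) ->
  trajectoid d n M p sig eps T.
Proof.
  intros Hpath HT; split.
  - intros s Hs; apply best_lt with a s; auto.
  - intros s Hs; destruct (breaks_isolated s) as (delta & Hd & Hiso).
    exists delta; split; auto; intros u Hu Hus.
    assert (HTs := HT s Hs); assert (HTu := HT u Hu).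
    destruct (breaks_locate u Hu) as [(j & Hj & He)|(j & Hj & Huj)].
    { destruct (Req_dec u s) as [->|Hne].
      - constructor; apply best_lt with a s; auto.
      - subst u; specialize (Hiso j Hj Hne); lra. }
    (* [u] is closer to [s] than any breakpoint other than [s], so none separates them. *)
    assert (Hsj : p j <= s <= p (S j)).
    { split; apply Rnot_lt_le; intros Hlt.
      - assert (Hi := Hiso j ltac:(lia) ltac:(lra)).
        rewrite Rabs_right in Hi by lra; rewrite Rabs_right in Hus by lra; lra.
      - assert (Hi := Hiso (S j) ltac:(lia) ltac:(lra)).
        rewrite Rabs_left in Hi by lra; rewrite Rabs_left in Hus by lra; lra. }
    apply eps_connected_trans with (a j).
    + destruct Hpath as [Ha Hc], HTs as [H1 H2].
      destruct (Req_dec s (p j)) as [He|Hne].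
      { rewrite (H2 j ltac:(lia) He); constructor; apply Ha; lia. }
      destruct (Req_dec s (p (S j))) as [He|Hne'].
      { rewrite (H2 (S j) Hj He), He; apply eps_connected_sym; auto. }
      apply eps_connected_sym, (H1 j Hj); lra.
    + apply (elementary_connected d n sig eps (p j) (p (S j)) u); auto.
      apply HTu; auto.
Qed.

Lemma trajectoid_path T : trajectoid d n M p sig eps T ->
  exists a, path a /\ forall j s, (j < M)%nat -> p j < s < p (S j) -> conn s (a j) (T s).
Proof.
  intros HT; assert (HT' := HT); destruct HT' as [HT1 HT2].
  (* Midpoint values represent the components on the open intervals; no interval follows [p M], so
     the last entry is the value there. *)
  set (a := fun j => if Nat.eq_dec j M then T (p M) else T ((p j + p (S j)) / 2)).
  assert (Hin : forall j s, (j < M)%nat -> p j <= s <= p (S j) -> p 0%nat <= s <= p M).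
  { intros j s Hj Hs; pose proof (breaks_le 0 j ltac:(lia) ltac:(lia)).
    pose proof (breaks_le (S j) M ltac:(lia) ltac:(lia)); lra. }
  assert (Hcl : forall j s, (j < M)%nat -> p j < s < p (S j) -> conn s (a j) (T s)).
  { intros j s Hj Hs; unfold a; destruct (Nat.eq_dec j M); [lia|].
    assert (p j < p (S j)) by auto.
    apply eps_connected_sym.
    apply (trajectoid_connected d n M p sig eps T (p j) (p (S j))); auto; try lra.
    - apply breaks_le; lia.
    - apply breaks_le; lia. }
  (* At an endpoint, the component of the adjacent open interval is reached by continuity. *)
  assert (Hend : forall j s, (j < M)%nat -> p j <= s <= p (S j) -> conn s (a j) (T s)).
  { intros j s Hj Hs; assert (Hjj : p j < p (S j)) by auto.
    destruct (HT2 s) as (delta & Hd & Hc); [apply (Hin j); auto|].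
    assert (Hu : exists u, p j < u < p (S j) /\ Rabs (u - s) < delta).
    { set (h := Rmin (delta / 2) ((p (S j) - p j) / 2)).
      assert (0 < h) by (apply Rmin_pos; lra).
      assert (h <= delta / 2) by apply Rmin_l.
      assert (h <= (p (S j) - p j) / 2) by apply Rmin_r.
      destruct (Rlt_le_dec s ((p j + p (S j)) / 2)).
      - exists (s + h / 2); split; [lra|apply Rabs_def1; lra].
      - exists (s - h / 2); split; [lra|apply Rabs_def1; lra]. }
    destruct Hu as (u & Hu & Hus).
    apply eps_connected_trans with (T u).
    - apply (elementary_connected d n sig eps (p j) (p (S j)) u); auto.
    - apply eps_connected_sym, Hc; auto; apply (Hin j); auto; lra. }
  exists a; split; auto; split.
  - intros j Hj; unfold a; destruct (Nat.eq_dec j M) as [->|].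
    + apply HT1; split; [apply breaks_le; lia|lra].
    + assert (p j < p (S j)) by (apply p_step; lia).
      apply HT1, (Hin j); [lia|lra].
  - intros j Hj; assert (p j < p (S j)) by auto.
    apply eps_connected_trans with (T (p (S j))); [apply Hend; auto; lra|].
    destruct (Nat.eq_dec (S j) M) as [He|Hne].
    + unfold a; rewrite He; destruct (Nat.eq_dec M M); [|tauto].
      constructor; apply HT1; split; [apply breaks_le; lia|lra].
    + assert (p (S j) < p (S (S j))) by (apply p_step; lia).
      apply eps_connected_sym, Hend; [lia|lra].
Qed.

(** The component of [a j] at the midpoint is its component throughout. An irreducible subset
    attains the same envelope, and its lower envelope of quadratics takes 5 pieces per member. *)
Lemma interval_pieces a j : path a -> (j < M)%nat ->
  exists S : list nat, NoDup S /\ (forall i, In i S -> (i < n)%nat) /\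
    (forall i, In i S -> exists s, p j < s < p (Datatypes.S j) /\
       forall i', In i' S -> i' <> i -> D i s < D i' s) /\
    parts (fun u v => (exists e, forall s, u < s < v -> best a e s) /\
      elementary d n sig eps u v) (5 * length S) (p j) (p (Datatypes.S j)).
Proof.
  intros [Ha _] Hj; assert (Hjj : p j < p (S j)) by auto.
  assert (Hel := p_elementary j Hj).
  set (m := (p j + p (S j)) / 2).
  assert (Hm : p j < m < p (S j)) by (unfold m; lra).
  destruct (list_of_pred (conn m (a j)) n) as (l & Hnd & Hl).
  destruct (irreducible_subset D l (p j) (p (S j)) Hnd) as (S & HS1 & HS2 & HS3 & HS4).
  assert (Haj : In (a j) l).
  { assert (a j < n)%nat by (apply Ha; lia); apply Hl; split; auto; constructor; auto. }
  exists S; split; [auto|split; [|split; auto]].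
  { intros i Hi; apply HS2, Hl in Hi; tauto. }
  (* The default (0, 0, 0) outside the index range makes the relation total, as [functional_choice]
     requires. *)
  assert (Hq : forall i, exists c, (i < n)%nat -> forall s, p j < s < p (Datatypes.S j) ->
    0 <= quad c s /\ D i s = sqrt (quad c s)).
  { intros i; destruct (Nat.lt_ge_cases i n) as [Hi|Hi].
    - destruct (proj2 (proj1 Hel) i Hi) as (c & Hc); exists c; auto.
    - exists (0, 0, 0); lia. }
  apply functional_choice in Hq as (q & Hq).
  eapply parts_mono; [|apply (parts_lowest q S); [lra|]].
  2: { intros ->; destruct (HS3 (a j) m Haj Hm) as (e & [] & _). }
  intros u v Hu Huv Hv (e & He & Hmin); split;
    [|apply (hereditary_elementary d n sig eps (p j) (p (Datatypes.S j))); auto].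
  exists e; intros s Hs; split; [|intros i Hi ->; exfalso; apply (breaks_not_open i j); auto; lra].
  intros i Hi His; assert (i = j) as -> by (apply (breaks_open_unique i j s); auto; lra).
  assert (HSn : forall i, In i S -> (i < n)%nat /\ conn m (a j) i).
  { intros i Hi'; apply HS2, Hl in Hi'; tauto. }
  split.
  - apply (elementary_connected d n sig eps (p j) (p (Datatypes.S j)) m); auto; [lra|].
    apply HSn; auto.
  - intros i Hc.
    destruct (HS3 i s) as (e' & He' & Hle); [|lra|].
    { apply Hl; split; [apply eps_connected_lt in Hc; tauto|].
      apply (elementary_connected d n sig eps (p j) (p (Datatypes.S j)) s); auto; lra. }
    apply Rle_trans with (D e' s); auto.
    destruct (Hq e (proj1 (HSn e He)) s His) as [_ ->].
    destruct (Hq e' (proj1 (HSn e' He')) s His) as [_ ->].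
    apply sqrt_le_1_alt, Hmin; auto.
Qed.

(* Two entities of the same irreducible set swap their order inside the
   interval, which bounds the sum of the squares of the sizes of these sets. *)
Lemma path_selection a K : path a ->
  (forall i i', (i < n)%nat -> (i' < n)%nat -> exists L : list R,
     (length L <= K)%nat /\ forall t t', p 0%nat <= t -> t < t' -> t' <= p M ->
       ~ (D i t <= D i' t <-> D i t' <= D i' t') -> exists r, In r L /\ t <= r <= t') ->
  exists (T : R -> nat) (k : nat),
    (forall s, p 0%nat <= s <= p M -> best a (T s) s) /\
    parts (fun u v => (exists e, forall s, u < s < v -> T s = e) /\
      elementary d n sig eps u v) k (p 0%nat) (p M) /\
    sqrt (INR n) * INR k <= 5 * (INR n * INR M + INR n ^ 2 * INR K).
Proof.
  intros Hpath HK.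
  assert (HS : forall j, exists S : list nat, (j < M)%nat ->
    NoDup S /\ (forall i, In i S -> (i < n)%nat) /\
    (forall i, In i S -> exists s, p j < s < p (Datatypes.S j) /\
       forall i', In i' S -> i' <> i -> D i s < D i' s) /\
    parts (fun u v => (exists e, forall s, u < s < v -> best a e s) /\
      elementary d n sig eps u v) (5 * length S) (p j) (p (Datatypes.S j))).
  { intros j; destruct (Nat.lt_ge_cases j M) as [Hj|Hj].
    - destruct (interval_pieces a j Hpath Hj) as (S & HS); exists S; auto.
    - exists nil; lia. }
  apply functional_choice in HS as (S & HS).
  destruct (select_pieces (best a) (elementary d n sig eps)
    (nsum (fun j => 5 * length (S j))%nat M) (p 0%nat) (p M)) as (T & HT & Hparts).
  { intros; apply best_exists; auto. }
  { apply parts_concat; intros j Hj; apply HS; auto. }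
  exists T, (nsum (fun j => 5 * length (S j))%nat M); split; [auto|split; [auto|]].
  set (chi := fun j i => if in_dec Nat.eq_dec i (S j) then 1%nat else 0%nat).
  assert (Hchi : forall j i, (chi j i <= 1)%nat).
  { intros j i; unfold chi; destruct (in_dec Nat.eq_dec i (S j)); lia. }
  assert (Hpairs : forall i i', (i < n)%nat -> (i' < n)%nat -> i <> i' ->
    (nsum (fun j => chi j i * chi j i') M <= K)%nat).
  { intros i i' Hi Hi' Hne; destruct (HK i i' Hi Hi') as (L & HL & Hsw).
    apply Nat.le_trans with (length L); auto.
    apply disjoint_intervals_count with p; auto.
    - intros j _; pose proof (Hchi j i); pose proof (Hchi j i'); nia.
    - intros j Hj; unfold chi.
      destruct (in_dec Nat.eq_dec i (S j)) as [Hin|]; [|lia].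
      destruct (in_dec Nat.eq_dec i' (S j)) as [Hin'|]; [|lia]; intros _.
      destruct (HS j Hj) as (_ & _ & Hirr & _).
      destruct (Hirr i Hin) as (t & Ht & Hlt); specialize (Hlt i' Hin' (not_eq_sym Hne)).
      destruct (Hirr i' Hin') as (t' & Ht' & Hlt'); specialize (Hlt' i Hin Hne).
      pose proof (breaks_le 0 j ltac:(lia) ltac:(lia)).
      pose proof (breaks_le (Datatypes.S j) M ltac:(lia) ltac:(lia)).
      destruct (Rtotal_order t t') as [Htt|[->|Htt]]; [|lra|].
      + destruct (Hsw t t') as (r & Hr & Hb); try lra.
        exists r; split; auto; lra.
      + destruct (Hsw t' t) as (r & Hr & Hb); try lra.
        exists r; split; auto; lra. }
  set (x := fun j => nsum (chi j) n).
  assert (Hcount := pair_count chi M n K Hchi Hpairs).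
  assert (Hk : (nsum (fun j => 5 * length (S j)) M <= 5 * nsum x M)%nat).
  { rewrite <- nsum_scal; apply nsum_le; intros j Hj.
    destruct (HS j Hj) as (Hnd & Hlt & _).
    pose proof (length_le_nsum (S j) n Hnd Hlt); unfold x, chi; lia. }
  assert (Hn1 : 1 <= INR n).
  { apply (le_INR 1); destruct Hpath as [Hlt _]; specialize (Hlt 0%nat); lia. }
  (* With r = sqrt n and X the total size, AM-GM and [Hcount] give (2 r - 1) X <= n M + n^2 K, and r
     <= 2 r - 1 because r >= 1. *)
  assert (Hgm := nsum_am_gm x M (sqrt (INR n))).
  rewrite pow2_sqrt in Hgm by lra.
  assert (Hr1 : 1 <= sqrt (INR n)) by (rewrite <- sqrt_1; apply sqrt_le_1_alt; auto).
  apply le_INR in Hcount; rewrite plus_INR, !mult_INR in Hcount.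
  apply le_INR in Hk; rewrite mult_INR in Hk; replace (INR 5) with 5 in Hk by (simpl; lra).
  fold x in Hcount; change (fun j => (nsum (chi j) n * nsum (chi j) n)%nat)
    with (fun j => (x j * x j)%nat) in Hcount.
  pose proof (pos_INR (nsum x M)).
  set (X := INR (nsum x M)) in *.
  apply Rle_trans with (sqrt (INR n) * (5 * X)); [apply Rmult_le_compat_l; lra|].
  nra.
Qed.

End ElementaryPartition.

(** * Existence of a central trajectory and the final bound *)

(** Only the entries up to [M] matter, so paths are encoded by words of length [M + 1], of which
    there are finitely many. *)
Lemma path_word d n sig eps M p a : path d n sig eps M p a ->
  exists w, In w (words n (S M)) /\ (forall j, (j <= M)%nat -> nth j w 0%nat = a j) /\
    path d n sig eps M p (fun j => nth j w 0%nat).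
Proof.
  intros [H1 H2]; exists (map a (seq 0 (S M))).
  assert (Hnth : forall j, (j <= M)%nat -> nth j (map a (seq 0 (S M))) 0%nat = a j).
  { intros j Hj; rewrite (nth_indep _ 0%nat (a 0%nat)) by
      (rewrite length_map, length_seq; lia).
    rewrite map_nth, seq_nth by lia; auto. }
  split; [|split; auto].
  - replace (S M) with (length (map a (seq 0 (S M)))) at 2 by
      (rewrite length_map, length_seq; auto).
    apply in_words; intros x Hx; apply in_map_iff in Hx as (j & <- & Hj).
    apply in_seq in Hj; apply H1; lia.
  - split; intros j Hj; rewrite !Hnth by lia; auto.
Qed.

Theorem mainTheorem14 :
  forall d : nat, (1 <= d)%nat ->
  exists C : R, C > 0 /\
  forall (n tau : nat) (tm : nat -> R) (sig : traj) (eps : R),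
    (1 <= n)%nat -> (1 <= tau)%nat -> eps > 0 ->
    increasing_times tau tm ->
    piecewise_linear d n tau tm sig ->
    general_position d n tau tm sig eps ->
    exists (T : R -> nat) (k : nat),
      central_trajectory d n tau tm sig eps T /\
      complexity_le d tau tm sig T k /\
      INR k <= C * INR tau * (INR n ^ 2 * sqrt (INR n)).
Proof.
  (* 260 = 5 (12 + 40): 5 pieces per envelope member, 12 n^2 tau intervals, 40 n tau switch points
     per pair. *)
  intros d _; exists 260; split; [lra|].
  intros n tau tm sig eps Hn _ Heps Hinc Hpl _.
  destruct (parts_sequence _ _ _ _ (parts_elementary d n tau tm sig eps Heps Hn Hinc Hpl))
    as (M & p & HM & Hp0 & HpM & Hp).
  assert (p_step : forall j, (j < M)%nat -> p j < p (S j)) by apply Hp.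
  assert (p_el : forall j, (j < M)%nat -> elementary d n sig eps (p j) (p (S j))) by apply Hp.
  set (K := (40 * n * tau)%nat).
  assert (HK : forall i i', (i < n)%nat -> (i' < n)%nat -> exists L : list R,
     (length L <= K)%nat /\ forall t t', p 0%nat <= t -> t < t' -> t' <= p M ->
       ~ (Dmax d n sig i t <= Dmax d n sig i' t <-> Dmax d n sig i t' <= Dmax d n sig i' t') ->
       exists r, In r L /\ t <= r <= t').
  { rewrite Hp0, HpM; intros; apply Dmax_switches; auto. }
  (* The bound on the number of pieces is part of [Q], so the minimiser over all words inherits
     it. *)
  set (Q := fun w T => let a := fun j => nth j w 0%nat in path d n sig eps M p a /\
    (forall s, p 0%nat <= s <= p M -> best d n sig eps M p a (T s) s) /\
    exists k : nat,
      parts (fun u v => (exists e, forall s, u < s < v -> T s = e) /\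
        elementary d n sig eps u v) k (p 0%nat) (p M) /\
      sqrt (INR n) * INR k <= 5 * (INR n * INR M + INR n ^ 2 * INR K)).
  assert (HQ : forall a, path d n sig eps M p a -> exists w T,
    In w (words n (S M)) /\ (forall j, (j <= M)%nat -> nth j w 0%nat = a j) /\ Q w T).
  { intros a Ha; destruct (path_word _ _ _ _ _ _ _ Ha) as (w & Hw & Hnth & Hpw).
    destruct (path_selection d n sig eps M p p_step p_el _ K Hpw HK) as (T & k & HT & Hk & Hb).
    exists w, T; split; [auto|split; [auto|]]; split; [auto|split; [auto|]]; exists k; auto. }
  assert (Hex : forall w T, Q w T -> ex_RInt (cost d n sig T) (p 0%nat) (p M)).
  { intros w T (Hpw & HT & k & Hk & _); eapply cost_ex_RInt; [|exact Hk].
    intros s Hs; eapply best_lt; eauto. }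
  destruct (finite_min (words n (S M)) Q
    (fun T => RInt (cost d n sig T) (p 0%nat) (p M))) as (w & T & Hw & HwT & Hmin).
  { destruct (HQ (fun _ => 0%nat)) as (w & T & Hw & _ & HT); [|eauto].
    split; intros; [lia|constructor; lia]. }
  assert (HwT' := HwT); destruct HwT' as (Hpw & HT & k & Hk & Hbound).
  destruct (parts_sequence _ _ _ _ Hk) as (m & b & Hm & Hb0 & Hbm & Hb).
  exists T, m; split; [split|split].
  - rewrite Hp0, HpM in HT.
    assert (Htr := best_trajectoid d n sig eps M p p_step p_el _ T Hpw).
    unfold trajectoid in *; rewrite Hp0, HpM in Htr; auto.
  - assert (HexT := Hex w T HwT).
    rewrite <- Hp0, <- HpM.
    exists (ex_RInt_Reals_0 _ _ _ HexT); intros T' HT' pr'.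
    rewrite <- !RInt_Reals.
    assert (Htr' : trajectoid d n M p sig eps T') by
      (unfold trajectoid in *; rewrite Hp0, HpM; auto).
    (* The competitor follows the components of some path [a]; any best selection along [a] costs at
       most as much at every time inside the intervals. *)
    destruct (trajectoid_path d n sig eps M p p_step p_el T' Htr') as (a & Ha & HaT').
    destruct (HQ a Ha) as (w' & T0 & Hw' & Hnth & HT0).
    destruct (Hmin w' T0 Hw' HT0) as (T1 & HT1 & Hle).
    eapply Rle_trans; [exact Hle|].
    apply RInt_le_pieces; auto; [eapply Hex; eauto|apply ex_RInt_Reals_1; auto|].
    intros j s Hj Hs; destruct HT1 as (_ & Hbest & _).
    destruct (Hbest s) as [Hbs _].
    { pose proof (breaks_le M p p_step 0 j ltac:(lia) ltac:(lia)).
      pose proof (breaks_le M p p_step (S j) M ltac:(lia) ltac:(lia)); lra. }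
    apply (Hbs j Hj Hs); rewrite Hnth by lia; auto.
  - exists b; rewrite Hb0, Hbm; split; [auto|split; [auto|split]].
    + intros i Hi; apply Hb; auto.
    + intros i Hi; destruct (Hb i Hi) as (Hlt & (e & He) & ((P & V & Hlin) & _) & _).
      exists e, (P e), (V e); intros s Hs; split; auto; intros j Hj.
      apply Hlin; auto; [|lra].
      assert (Hrange : p 0%nat <= s <= p M).
      { assert (b_step : forall j, (j < m)%nat -> b j < b (S j)) by apply Hb.
        pose proof (breaks_le m b b_step 0 i ltac:(lia) ltac:(lia)).
        pose proof (breaks_le m b b_step (S i) m ltac:(lia) ltac:(lia)); lra. }
      rewrite <- (He s Hs); apply (best_lt d n sig eps M p p_step _ (T s) s Hpw); auto.
  - assert (Hn1 : 1 <= INR n) by (apply (le_INR 1); auto).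
    assert (Hr1 : 1 <= sqrt (INR n)) by (rewrite <- sqrt_1; apply sqrt_le_1_alt; auto).
    assert (Hr2 : sqrt (INR n) * sqrt (INR n) = INR n) by (apply sqrt_sqrt; lra).
    apply le_INR in HM, Hm; rewrite !mult_INR in HM.
    unfold K in Hbound; rewrite !mult_INR in Hbound.
    replace (INR 12) with 12 in HM by (simpl; lra).
    replace (INR 40) with 40 in Hbound by (simpl; lra).
    (* Multiplying by sqrt n matches the form of [Hbound] and turns the target into 260 tau n^3. *)
    apply Rmult_le_reg_l with (sqrt (INR n)); [lra|].
    apply Rle_trans with (sqrt (INR n) * INR k); [apply Rmult_le_compat_l; lra|].
    eapply Rle_trans; [exact Hbound|].
    replace (sqrt (INR n) * (260 * INR tau * (INR n ^ 2 * sqrt (INR n)))) with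
      (5 * (INR n * (12 * INR n * INR n * INR tau) + INR n ^ 2 * (40 * INR n * INR tau))).
    + apply Rmult_le_compat_l; [lra|]; apply Rplus_le_compat_r, Rmult_le_compat_l; lra.
    + transitivity (260 * INR tau * INR n ^ 2 * (sqrt (INR n) * sqrt (INR n)));
        [rewrite Hr2; ring|ring].
Qed.
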